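(* Let $g$ be a symmetric, non-singular type $(0,2)$ tensor field on $Q$ (a pseudo-Riemannian metric), let $L=\frac12g_{ij}u^iu^j$ on $TQ$, and let $J$ be a type $(1,1)$ tensor field on $Q$. Then $$J=\overline J\ \text{ and }\ \nabla J=0\quad\Longrightarrow\quad \Phi J=J\Phi .$$
   Context: $Q$ is a smooth manifold, $\tau:TQ\to Q$ has natural coordinates $(q^i,u^i)$. $\overline J$ is the transpose of $J$ with respect to $g$: $g(JX,Y)=g(X,\overline JY)$. $\nabla J$ is the type $(1,1)$ tensor field along $\tau$ with components $(\nabla J)^i_j=J^i_{j|k}u^k$, where $|$ is the Levi-Civita covariant derivative of $g$. The Jacobi endomorphism $\Phi$ is the type $(1,1)$ tensor field along $\tau$ associated with the geodesic spray $\Gamma=u^i\frac{\partial}{\partial q^i}-\Gamma^i_{jk}u^ju^k\frac{\partial}{\partial u^i}$ of $g$ (the Euler-Lagrange field of $L$; $\Gamma^i_{jk}$ the Christoffel symbols), defined by $[\Gamma,X^H]=(\nabla X)^H+(\Phi X)^V$ for vector fields $X$ along $\tau$, where $X^V=X^i\frac{\partial}{\partial u^i}$, $X^H=X^i\big(\frac{\partial}{\partial q^i}-\Gamma^k_{ij}u^j\frac{\partial}{\partial u^k}\big)$ and $\nabla X=(\Gamma(X^i)+\Gamma^i_{jk}u^kX^j)\frac{\partial}{\partial q^i}$. In components $\Phi^i_j=R^i_{ljk}u^ku^l$, with $R^i_{ljk}$ the Riemann curvature tensor, skew-symmetric in the last two subscripts. *)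

(* Defs.v *)
From HB Require Import structures.
From mathcomp Require Import all_boot all_order all_algebra.
From mathcomp Require Import all_classical all_reals all_analysis.
From mathcomp Require Import ring.

Set Implicit Arguments.
Unset Strict Implicit.
Unset Printing Implicit Defensive.

Import Order.TTheory GRing.Theory Num.Theory.
Import numFieldNormedType.Exports.
Local Open Scope classical_set_scope.
Local Open Scope ring_scope.

(** ** Smooth functions *)

Definition iter_derive (R : realType) (V : normedModType R) (f : V -> R)
    (s : seq V) : V -> R :=
  foldr (fun v h x => 'D_v h x) f s.

(* On an open subset [U] of a finite-dimensional [V] this is C^oo: all
   iterated directional derivatives along constant vectors (in particular all
   iterated partial derivatives) exist and are continuous. *)
Definition smooth_on (R : realType) (V : normedModType R) (U : set V)
    (f : V -> R) : Prop :=
  forall (s : seq V) (x : V), U x ->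
    {for x, continuous (iter_derive f s)} /\
    (forall v : V, derivable (iter_derive f s) x v).

(** ** Smooth manifolds *)

Record chart (R : realType) (n : nat) (M : topologicalType) := Chart {
  source : set M;
  target : set 'rV[R]_n;
  coords : M -> 'rV[R]_n;
  param : 'rV[R]_n -> M;
  open_source : open source;
  open_target : open target;
  coords_target : forall p, source p -> target (coords p);
  param_source : forall x, target x -> source (param x);
  coordsK : forall p, source p -> param (coords p) = p;
  paramK : forall x, target x -> coords (param x) = x;
  coords_continuous : {within source, continuous coords};
  param_continuous : {within target, continuous param} }.

Definition overlap (R : realType) (n : nat) (M : topologicalType)
    (a b : chart R n M) : set 'rV[R]_n :=
  target a `&` (param a @^-1` source b).

Definition transition (R : realType) (n : nat) (M : topologicalType)
    (a b : chart R n M) (x : 'rV[R]_n) : 'rV[R]_n :=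
  coords b (param a x).

(* The atlas is not required to be maximal. *)
Record smooth_manifold (R : realType) (n : nat) := SmoothManifold {
  points :> topologicalType;
  manifold_hausdorff : hausdorff_space points;
  manifold_second_countable : @second_countable points;
  charts : Type;
  atlas : charts -> chart R n points;
  atlas_cover : forall p : points, exists a, source (atlas a) p;
  atlas_compatible : forall (a b : charts) (i : 'I_n),
    smooth_on (overlap (atlas a) (atlas b))
      (fun x => transition (atlas a) (atlas b) x 0 i) }.

(* The Jacobian matrix of the coordinate change from [a] to [b], with entry
   d xbar^i / d x^j at (i, j); the library's [jacobian] acts on row vectors. *)
Definition jac (R : realType) (n : nat) (Q : smooth_manifold R n)
    (a b : charts Q) (x : 'rV[R]_n) : 'M[R]_n :=
  (jacobian (transition (atlas a) (atlas b)) x)^T.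

(** ** Tensor fields

   A tensor field is given by its components in the charts of the atlas, as
   functions of the coordinates, subject to the tensorial transformation law.
   Only the values on the target of the chart are meaningful. *)

(* [cov g a x i j] is g_ij at the point with coordinates [x]. *)
Record tensor02 (R : realType) (n : nat) (Q : smooth_manifold R n) := Tensor02 {
  cov :> charts Q -> 'rV[R]_n -> 'M[R]_n;
  cov_smooth : forall a i j,
    smooth_on (target (atlas a)) (fun x => cov a x i j);
  cov_change : forall a b x, overlap (atlas a) (atlas b) x ->
    cov a x = (jac a b x)^T *m cov b (transition (atlas a) (atlas b) x)
              *m jac a b x }.

(* [endo J a x i j] is J^i_j: the upper index is the row index. *)
Record tensor11 (R : realType) (n : nat) (Q : smooth_manifold R n) := Tensor11 {
  endo :> charts Q -> 'rV[R]_n -> 'M[R]_n;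
  endo_smooth : forall a i j,
    smooth_on (target (atlas a)) (fun x => endo a x i j);
  endo_change : forall a b x, overlap (atlas a) (atlas b) x ->
    jac a b x *m endo a x =
    endo b (transition (atlas a) (atlas b) x) *m jac a b x }.

(* The range in [R^n * R^n] of the natural coordinates (q, u) on the tangent
   bundle over the chart [a]. *)
Definition tangent_target (R : realType) (n : nat) (Q : smooth_manifold R n)
    (a : charts Q) : set ('rV[R]_n * 'rV[R]_n) :=
  target (atlas a) `*` setT.

(* Type (1,1) tensor fields along tau : TQ -> Q. *)
Record tensor11_along (R : realType) (n : nat) (Q : smooth_manifold R n) :=
  Tensor11Along {
  endo_along :> charts Q -> 'rV[R]_n * 'rV[R]_n -> 'M[R]_n;
  endo_along_smooth : forall a i j,
    smooth_on (tangent_target a) (fun z => endo_along a z i j);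
  endo_along_change : forall a b x u, overlap (atlas a) (atlas b) x ->
    jac a b x *m endo_along a (x, u) =
    endo_along b (transition (atlas a) (atlas b) x, u *m (jac a b x)^T)
      *m jac a b x }.

Definition symmetric_tensor (R : realType) (n : nat) (Q : smooth_manifold R n)
    (g : tensor02 Q) : Prop :=
  forall a x, target (atlas a) x -> (g a x)^T = g a x.

Definition nonsingular (R : realType) (n : nat) (Q : smooth_manifold R n)
    (g : tensor02 Q) : Prop :=
  forall a x, target (atlas a) x -> g a x \in unitmx.

Definition eq_tensor11 (R : realType) (n : nat) (Q : smooth_manifold R n)
    (J K : tensor11 Q) : Prop :=
  forall a x, target (atlas a) x -> J a x = K a x.

(* [K] is the transpose of [J] with respect to [g]: g(JX, Y) = g(X, KY). *)
Definition is_transpose (R : realType) (n : nat) (Q : smooth_manifold R n)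
    (g : tensor02 Q) (J K : tensor11 Q) : Prop :=
  forall a x, target (atlas a) x -> forall X Y : 'cV[R]_n,
    (J a x *m X)^T *m g a x *m Y = X^T *m g a x *m (K a x *m Y).

(** ** The Levi-Civita connection *)

Definition partial (R : realType) (n : nat) (k : 'I_n) (f : 'rV[R]_n -> R)
    (x : 'rV[R]_n) : R :=
  'D_(delta_mx 0 k) f x.

(* Gamma^i_jk *)
Definition christoffel (R : realType) (n : nat) (Q : smooth_manifold R n)
    (g : tensor02 Q) (a : charts Q) (i j k : 'I_n) (x : 'rV[R]_n) : R :=
  2^-1 * \sum_(l < n) invmx (g a x) i l *
    (partial j (fun y => g a y l k) x + partial k (fun y => g a y l j) x
     - partial l (fun y => g a y j k) x).

(* J^i_{j|k} *)
Definition covariant_derivative (R : realType) (n : nat)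
    (Q : smooth_manifold R n) (g : tensor02 Q) (J : tensor11 Q) (a : charts Q)
    (i j k : 'I_n) (x : 'rV[R]_n) : R :=
  partial k (fun y => J a y i j) x
  + \sum_(l < n) christoffel g a i k l x * J a x l j
  - \sum_(l < n) christoffel g a l k j x * J a x i l.

(* (nabla J)^i_j = J^i_{j|k} u^k, the components at (q, u) = z of a type (1,1)
   tensor field along tau. *)
Definition nabla_endo (R : realType) (n : nat) (Q : smooth_manifold R n)
    (g : tensor02 Q) (J : tensor11 Q) (a : charts Q)
    (z : 'rV[R]_n * 'rV[R]_n) : 'M[R]_n :=
  \matrix_(i < n, j < n)
    \sum_(k < n) covariant_derivative g J a i j k z.1 * z.2 0 k.

(** ** Vector fields on TQ, in natural coordinates *)

(* The vector field dq^i d/dq^i + du^i d/du^i. *)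
Record tangent_field (R : realType) (n : nat) := TangentField {
  dq : 'I_n -> 'rV[R]_n * 'rV[R]_n -> R;
  du : 'I_n -> 'rV[R]_n * 'rV[R]_n -> R }.

Definition partial_q (R : realType) (n : nat) (k : 'I_n)
    (F : 'rV[R]_n * 'rV[R]_n -> R) (z : 'rV[R]_n * 'rV[R]_n) : R :=
  'D_(delta_mx 0 k, 0) F z.

Definition partial_u (R : realType) (n : nat) (k : 'I_n)
    (F : 'rV[R]_n * 'rV[R]_n -> R) (z : 'rV[R]_n * 'rV[R]_n) : R :=
  'D_(0, delta_mx 0 k) F z.

Definition lie_derive (R : realType) (n : nat) (A : tangent_field R n)
    (F : 'rV[R]_n * 'rV[R]_n -> R) (z : 'rV[R]_n * 'rV[R]_n) : R :=
  \sum_(i < n) (dq A i z * partial_q i F z + du A i z * partial_u i F z).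

Definition lie_bracket (R : realType) (n : nat) (A B : tangent_field R n) :
    tangent_field R n :=
  TangentField
    (fun i z => lie_derive A (dq B i) z - lie_derive B (dq A i) z)
    (fun i z => lie_derive A (du B i) z - lie_derive B (du A i) z).

Definition tangent_add (R : realType) (n : nat) (A B : tangent_field R n) :
    tangent_field R n :=
  TangentField (fun i z => dq A i z + dq B i z) (fun i z => du A i z + du B i z).

(** ** The geodesic spray and the Jacobi endomorphism *)

Definition geodesic_spray (R : realType) (n : nat) (Q : smooth_manifold R n)
    (g : tensor02 Q) (a : charts Q) : tangent_field R n :=
  TangentField
    (fun i z => z.2 0 i)
    (fun i z => - \sum_(j < n) \sum_(k < n)
                    christoffel g a i j k z.1 * z.2 0 j * z.2 0 k).

(* L = 1/2 g_ij u^i u^j *)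
Definition lagrangian (R : realType) (n : nat) (Q : smooth_manifold R n)
    (g : tensor02 Q) (a : charts Q) (z : 'rV[R]_n * 'rV[R]_n) : R :=
  2^-1 * \sum_(i < n) \sum_(j < n) g a z.1 i j * z.2 0 i * z.2 0 j.

Lemma is_derive_velocity (R : realType) n (i : 'I_n) (x u v w : 'rV[R]_n) :
  is_derive (x,u) (v,w) (fun z : 'rV[R]_n * 'rV[R]_n => z.2 0 i) (w 0 i).
Proof.
have H : (fun h : R => h^-1 *: ((h *: w + u) 0 i - u 0 i)) @ 0^' --> (w 0 i : R).
  apply: cvg_near_cst; near=> h.
  rewrite !mxE addrK /GRing.scale /= mulrA mulVf ?mul1r //.
  by near: h; exact: nbhs_dnbhs_neq.
by split; [apply/cvg_ex; exists (w 0 i)|exact: cvg_lim].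
Unshelve. all: by end_near.
Qed.

Lemma is_derive_base (R : realType) n (f : 'rV[R]_n -> R) (x u v w : 'rV[R]_n) :
  derivable f x v ->
  is_derive (x,u) (v,w) (fun z : 'rV[R]_n * 'rV[R]_n => f z.1) ('D_v f x).
Proof. by move=> df; split. Qed.

Lemma is_derive_lagrangian (R : realType) n (Q : smooth_manifold R n)
  (g : tensor02 Q) a (x u v w : 'rV[R]_n) : target (atlas a) x ->
  is_derive (x, u) (v, w) (lagrangian g a)
   (2^-1 * \sum_i \sum_j ('D_v (fun y => g a y i j) x * u 0 i * u 0 j +
     g a x i j * (w 0 i * u 0 j + u 0 i * w 0 j))).
Proof.
move=> xa.
have -> : lagrangian g a = 2^-1 \*: (\sum_i \sum_j
   ((fun z : 'rV[R]_n * 'rV[R]_n => g a z.1 i j) * (fun z => z.2 0 i) * (fun z => z.2 0 j)) : _ -> R).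
  apply/funext => z; rewrite /lagrangian /= !fct_sumE; congr (_ * _).
  by apply: eq_bigr => i _; rewrite fct_sumE.
apply: is_deriveZ; apply: is_derive_sum => i; apply: is_derive_sum => j.
have D := is_derive_base u w (proj2 (@cov_smooth _ _ _ g a i j [::] x xa) v).
have Di := is_derive_velocity i x u v w.
have Dj := is_derive_velocity j x u v w.
apply: is_derive_eq; rewrite /GRing.scale /=.
rewrite !/(GRing.mul (_ : _ -> _) _) /=; ring.
Qed.


(* The geodesic spray is the Euler-Lagrange field of [lagrangian g]:
   Gamma(dL/du^k) = dL/dq^k. *)
Lemma geodesic_spray_euler_lagrange (R : realType) (n : nat) (Q : smooth_manifold R n)
    (g : tensor02 Q) (a : charts Q) (k : 'I_n) z :
  symmetric_tensor g -> nonsingular g -> tangent_target a z ->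
  lie_derive (geodesic_spray g a) (partial_u k (lagrangian g a)) z =
  partial_q k (lagrangian g a) z.
Proof.
case: z => x u gs gn [/= xa _].
pose p : 'rV[R]_n * 'rV[R]_n -> R :=
  \sum_j ((fun z : 'rV[R]_n * 'rV[R]_n => g a z.1 k j) * (fun z => z.2 0 j)).
have Dp v w : is_derive (x, u) (v, w) p
   (\sum_j ('D_v (fun y => g a y k j) x * u 0 j + g a x k j * w 0 j)).
  apply: is_derive_sum => j.
  have D := is_derive_base u w (proj2 (@cov_smooth _ _ _ g a k j [::] x xa) v).
  have Dj := is_derive_velocity j x u v w.
  by apply: is_derive_eq; rewrite /GRing.scale /= addrC (mulrC (u 0 j)).
have pE : \forall z \near (x, u), partial_u k (lagrangian g a) z = p z.
  have : \forall z \near (x,u), target (atlas a) z.1.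
    exists (target (atlas a), setT) => [|[y w] []//].
    by split; [exact: open_nbhs_nbhs (conj (@open_target _ _ _ (atlas a)) xa)|exact: filterT].
  apply: filterS => -[y w] /= ya.
  rewrite /partial_u (@derive_val _ _ _ _ _ _ _ (is_derive_lagrangian g w 0 (delta_mx 0 k) ya)).
  rewrite /p fct_sumE.
  under eq_bigr do under eq_bigr do rewrite derive0 !mul0r add0r mulrDr.
  under eq_bigr do rewrite big_split.
  rewrite big_split /= (bigD1 k) //= [X in _ + X + _]big1 ?addr0; last first.
    move=> i ik; apply: big1 => j _; by rewrite mxE (negbTE ik) andbF mul0r mulr0.
  have -> : \sum_i \sum_i0 g a y i i0 * (w 0 i * (delta_mx 0 k : 'rV[R]_n) 0 i0) = \sum_j g a y k j * w 0 j.
    apply: eq_bigr => i _; rewrite (bigD1 k) //= big1 ?addr0; last first.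
      by move=> j jk; rewrite mxE (negbTE jk) andbF !mulr0.
    by rewrite mxE !eqxx mulr1 -[in LHS](gs _ _ ya) [in LHS]mxE.
  under eq_bigr do rewrite mxE !eqxx mul1r.
  by field.
rewrite /lie_derive {2}/partial_q.
rewrite (@derive_val _ _ _ _ _ _ _ (is_derive_lagrangian g u (delta_mx 0 k) 0 xa)).
have Eq i : partial_q i (partial_u k (lagrangian g a)) (x, u)
    = \sum_j partial i (fun y => g a y k j) x * u 0 j.
  rewrite /partial_q (near_eq_derive _ pE) derive_val.
  by apply: eq_bigr => j _; rewrite mxE mulr0 addr0.
have Eu i : partial_u i (partial_u k (lagrangian g a)) (x, u) = g a x k i.
  rewrite /partial_u (near_eq_derive _ pE) derive_val.
  rewrite (bigD1 i) //= big1 ?addr0 => [|j ji]; rewrite derive0 mul0r add0r mxE.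
    by rewrite !eqxx mulr1.
  by rewrite (negbTE ji) andbF mulr0.
under eq_bigr do rewrite Eq Eu.
rewrite big_split /=.
have lower j l : \sum_i g a x k i * christoffel g a i j l x =
    2^-1 * (partial j (fun y => g a y k l) x + partial l (fun y => g a y k j) x
     - partial k (fun y => g a y j l) x).
  under eq_bigr do rewrite /christoffel mulrCA mulr_sumr.
  rewrite -mulr_sumr exchange_big /=; congr (_ * _).
  under eq_bigr do (under eq_bigr do rewrite mulrA; rewrite -mulr_suml).
  have inv m : \sum_i g a x k i * invmx (g a x) i m = (k == m)%:R.
    by have := mulmxV (gn _ _ xa) => /matrixP /(_ k m); rewrite !mxE.
  under eq_bigr do rewrite inv.
  rewrite (bigD1 k) //= eqxx mul1r big1 ?addr0 // => m mk.
  by rewrite eq_sym (negbTE mk) mul0r.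
have -> : \sum_i (- (\sum_j \sum_k0 christoffel g a i j k0 x * u 0 j * u 0 k0)) * g a x k i
   = - \sum_j \sum_l (\sum_i g a x k i * christoffel g a i j l x) * u 0 j * u 0 l.
  under eq_bigr do rewrite mulNr mulr_suml.
  rewrite sumrN exchange_big /=; congr (- _); apply: eq_bigr => j _.
  under eq_bigr do rewrite mulr_suml.
  rewrite exchange_big /=; apply: eq_bigr => l _.
  rewrite !mulr_suml; apply: eq_bigr => i _; ring.
under [X in _ - X]eq_bigr do under eq_bigr do rewrite lower.
have -> : \sum_i u 0 i * (\sum_j partial i (fun y => g a y k j) x * u 0 j)
  = 2^-1 * \sum_i \sum_j (partial i (fun y => g a y k j) x * u 0 i * u 0 j
     + partial j (fun y => g a y k i) x * u 0 i * u 0 j).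
  have S : \sum_i \sum_j partial i (fun y => g a y k j) x * u 0 i * u 0 j
     = \sum_i \sum_j partial j (fun y => g a y k i) x * u 0 i * u 0 j.
    rewrite exchange_big /=; apply: eq_bigr => i _; apply: eq_bigr => j _; ring.
  under [in RHS]eq_bigr do rewrite big_split.
  rewrite big_split /= -S.
  transitivity (\sum_i \sum_j partial i (fun y => g a y k j) x * u 0 i * u 0 j).
    by apply: eq_bigr => i _; rewrite mulr_sumr; apply: eq_bigr => j _; ring.
  by field.
rewrite !mulr_sumr -sumrB; apply: eq_bigr => i _.
rewrite !mulr_sumr -sumrB; apply: eq_bigr => j _.
rewrite /partial !mxE; ring.
Qed.

(* In a chart a vector field along tau, X^i(q, u) d/dq^i, is given by the
   functions X^i; the lifts X^V and X^H are vector fields on TQ. *)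
Definition vertical_lift (R : realType) (n : nat)
    (X : 'I_n -> 'rV[R]_n * 'rV[R]_n -> R) : tangent_field R n :=
  TangentField (fun _ _ => 0) X.

Definition horizontal_lift (R : realType) (n : nat) (Q : smooth_manifold R n)
    (g : tensor02 Q) (a : charts Q) (X : 'I_n -> 'rV[R]_n * 'rV[R]_n -> R) :
    tangent_field R n :=
  TangentField X
    (fun k z => - \sum_(i < n) \sum_(j < n)
                    X i z * christoffel g a k i j z.1 * z.2 0 j).

Definition nabla_field (R : realType) (n : nat) (Q : smooth_manifold R n)
    (g : tensor02 Q) (a : charts Q) (X : 'I_n -> 'rV[R]_n * 'rV[R]_n -> R) :
    'I_n -> 'rV[R]_n * 'rV[R]_n -> R :=
  fun i z => lie_derive (geodesic_spray g a) (X i) z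
    + \sum_(j < n) \sum_(k < n) christoffel g a i j k z.1 * z.2 0 k * X j z.

(* [Phi] is the Jacobi endomorphism of the geodesic spray Gamma of [g]:
     [Gamma, X^H] = (nabla X)^H + (Phi X)^V
   for every vector field X along tau. The condition is local, so X runs over
   the vector fields along tau over the chart domains. *)
Definition is_jacobi_endomorphism (R : realType) (n : nat)
    (Q : smooth_manifold R n) (g : tensor02 Q) (Phi : tensor11_along Q) : Prop :=
  forall (a : charts Q) (X : 'I_n -> 'rV[R]_n * 'rV[R]_n -> R),
    (forall i, smooth_on (tangent_target a) (X i)) ->
    let lhs := lie_bracket (geodesic_spray g a) (horizontal_lift g a X) in
    let rhs := tangent_add
      (horizontal_lift g a (nabla_field g a X))
      (vertical_lift (fun i z => \sum_(j < n) Phi a z i j * X j z)) in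
    forall z, tangent_target a z -> forall i : 'I_n,
      dq lhs i z = dq rhs i z /\ du lhs i z = du rhs i z.

(* Main.v *)
Require Import Defs.
From mathcomp Require Import all_boot all_order all_algebra.
From mathcomp Require Import all_classical all_reals all_analysis.
From mathcomp Require Import ring lra.

Set Implicit Arguments.
Unset Strict Implicit.
Unset Printing Implicit Defensive.

Import Order.TTheory GRing.Theory Num.Theory.
Import numFieldNormedType.Exports.
Local Open Scope classical_set_scope.
Local Open Scope ring_scope.

(** Along a chart, everything follows from one property of the curvature of the
    Levi-Civita connection. Let Gamma_k be the matrix (Gamma^i_kj)_ij and
      R_mk = d_m Gamma_k - d_k Gamma_m + Gamma_m Gamma_k - Gamma_k Gamma_m.

    If a matrix-valued function A satisfies d_k A = A P_k - P'_k A for all k,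
    the symmetry of second derivatives of A forces A to intertwine the
    curvatures of P and P' ([parallel_curvature]). This is used twice. For g,
    with P = Gamma and P' = - Gamma^T ([connection_metric]), it says that
    K_mk = g R_mk is antisymmetric; together with K_km = - K_mk and the first
    Bianchi identity this gives the pair symmetry K_mj(l,k) = K_lk(m,j)
    ([curvature_pair_symmetry]). For J, with P = P' = Gamma, which is what
    nabla J = 0 says, it gives J R_mk = R_mk J ([riemann_comm]); as J is
    self-adjoint, J^T K_mk = K_mk J.

    Evaluating the defining identity of Phi on the coordinate fields d/dq^m
    yields Phi^i_m = (R_mj)^i_k u^j u^k ([jacobi_endomorphismE]); so g Phi is
    the bilinear form (X, Y) |-> R(Y, u; X, u). The remaining algebra
    ([jacobi_form_comm]) is as follows. Pair symmetry lets J pass from one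
    argument of a pair to the other, R(JX, Y; Z, W) = R(X, JY; Z, W), hence
      (g Phi J)(X, Y) = R(X, u; Y, Ju)  and  (J^T g Phi)(X, Y) = R(Y, u; X, Ju).
    By the Bianchi identity their difference is, up to sign, R(X, Y; Ju, u),
    the value at (u, u) of the form J^T K_XY, which is antisymmetric because
    J^T K_XY = K_XY J; so the difference vanishes. Therefore
    g Phi J = J^T g Phi = g J Phi, and g can be cancelled. *)

(** * Symmetry of second derivatives *)
Lemma is_derive_line (R : realType) (V : normedModType R) (f : V -> R)
    (y v : V) (s : R) :
  derivable f (y + s *: v) v ->
  is_derive s 1 (fun t => f (y + t *: v)) ('D_v f (y + s *: v)).
Proof.
move=> /derivableP[df dfE].
have E : (fun h : R => h^-1 *:
    (((fun t => f (y + t *: v)) \o shift s) (h *: 1) - f (y + s *: v)))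
  = (fun h : R => h^-1 *: ((f \o shift (y + s *: v)) (h *: v) - f (y + s *: v))).
  apply/funext => h /=; congr (_ *: (f _ - _)).
  by rewrite /shift /= scalerDl [h *: 1]mulr1 addrCA.
by split; [rewrite /derivable E | rewrite /derive E].
Qed.

(** The mean value theorem, used once along [v] and once along [w]. The left
    side is symmetric in [v] and [w], so that exchanging them compares the two
    mixed derivatives at nearby points. *)
Lemma second_difference (R : realType) (V : normedModType R) (U : set V)
    (f : V -> R) (x v w : V) (h : R) :
  smooth_on U f -> 0 < h ->
  (forall s t : R, 0 <= s <= h -> 0 <= t <= h -> U (x + s *: v + t *: w)) ->
  exists s t : R, [/\ 0 <= s <= h, 0 <= t <= h &
    f (x + h *: v + h *: w) - f (x + h *: v) - f (x + h *: w) + f x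
    = 'D_w (fun y => 'D_v f y) (x + s *: v + t *: w) * h * h].
Proof.
move=> fs h0 Uh.
have h00 : 0 <= (0 : R) <= h by rewrite lexx (ltW h0).
have hhh : 0 <= h <= h by rewrite lexx ltW.
have ow s : s \in `]0, h[%R -> 0 <= s <= h.
  by rewrite in_itv /= => /andP[/ltW -> /ltW ->].
have cw s : s \in `[0, h]%R -> 0 <= s <= h by rewrite in_itv.
pose p (s : R) : R := f ((x + h *: w) + s *: v) - f (x + s *: v).
pose dp (s : R) : R := 'D_v f ((x + h *: w) + s *: v) - 'D_v f (x + s *: v).
have Dp s : 0 <= s <= h -> is_derive s 1 p (dp s).
  move=> sh; apply: is_deriveB; apply: is_derive_line.
    rewrite addrAC; exact: (fs [::] _ (Uh _ _ sh hhh)).2.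
  by have := (fs [::] _ (Uh _ _ sh h00)).2 v; rewrite scale0r addr0.
have [||s sI E1] := @MVT R p dp 0 h h0.
- by move=> s /ow; exact: Dp.
- apply: derivable_within_continuous => s /cw sh.
  by have [] := Dp _ sh.
have {}sI := ow _ sI.
pose q (t : R) : R := 'D_v f ((x + s *: v) + t *: w).
have Dq t : 0 <= t <= h ->
    is_derive t 1 q ('D_w (fun y => 'D_v f y) ((x + s *: v) + t *: w)).
  move=> th; apply: (@is_derive_line _ _ (fun y => 'D_v f y)).
  exact: (fs [:: v] _ (Uh _ _ sI th)).2.
have [||t tI E2] := @MVT R q
  (fun t => 'D_w (fun y => 'D_v f y) ((x + s *: v) + t *: w)) 0 h h0.
- by move=> t /ow; exact: Dq.
- apply: derivable_within_continuous => t /cw th.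
  by have [] := Dq _ th.
have {}tI := ow _ tI.
exists s, t; split => //.
have -> : 'D_w (fun y => 'D_v f y) (x + s *: v + t *: w) * h = dp s.
  by move: E2; rewrite subr0 => <-; rewrite /q /dp scale0r addr0 [x + s *: v + _]addrAC.
move: E1; rewrite subr0 => <-; rewrite /p !scale0r !addr0 [x + h *: w + _]addrAC.
by ring.
Qed.

Lemma small_parallelogram (R : realType) (V : normedModType R) (N : set V)
    (x v w : V) : nbhs x N ->
  exists2 h : R, 0 < h &
    forall s t : R, 0 <= s <= h -> 0 <= t <= h -> N (x + s *: v + t *: w).
Proof.
move=> /nbhs_ballP[e /= e0 eN].
have K0 : 0 < `|v| + `|w| + 1 by rewrite ltr_wpDl ?addr_ge0.
exists (e / (`|v| + `|w| + 1)) => [|s t /andP[s0 sh] /andP[t0 th]]; first exact: divr_gt0.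
apply: eN; rewrite -ball_normE /ball_ /= -addrA opprD addNKr normrN.
rewrite (le_lt_trans (ler_normD _ _))// !normrZ !ger0_norm //.
set h := e / _ in sh th *.
apply: (@le_lt_trans _ _ (h * (`|v| + `|w|))).
  by rewrite mulrDr lerD // ler_wpM2r.
have h0 : 0 < h by exact: divr_gt0.
apply: (@lt_le_trans _ _ (h * (`|v| + `|w| + 1))); first by rewrite ltr_pM2l ?ltrDl.
by rewrite /h divfK // gt_eqF.
Qed.

(** Both mixed derivatives take the same value at two points of an arbitrarily
    small parallelogram at [x] ([second_difference] for (v, w) and for (w, v)),
    and both are continuous at [x]. *)
Lemma derive_comm (R : realType) (V : normedModType R) (U : set V)
    (f : V -> R) (x v w : V) :
  open U -> smooth_on U f -> U x ->
  'D_v (fun y => 'D_w f y) x = 'D_w (fun y => 'D_v f y) x.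
Proof.
move=> Uo fs Ux.
apply/eqP; rewrite -subr_eq0 -normr_eq0 eq_le normr_ge0 andbT.
apply/ler_addgt0Pl => e e0; rewrite addr0.
have e2 : 0 < e / 2 by rewrite divr_gt0.
have c1 := (fs [:: v; w] x Ux).1; have c2 := (fs [:: w; v] x Ux).1.
have n1 : \forall y \near x,
    `|iter_derive f [:: v; w] x - iter_derive f [:: v; w] y| < e / 2.
  exact: (@cvgr_dist_lt _ _ _ _ _ _ _ c1 _ e2).
have n2 : \forall y \near x,
    `|iter_derive f [:: w; v] x - iter_derive f [:: w; v] y| < e / 2.
  exact: (@cvgr_dist_lt _ _ _ _ _ _ _ c2 _ e2).
have nU : nbhs x U by exact: open_nbhs_nbhs.
have [h h0 Nh] := small_parallelogram v w (filterI nU (filterI n1 n2)).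
have [s [t [sh th E]]] := second_difference fs h0 (fun s t sh th => (Nh s t sh th).1).
have Uh s' t' : 0 <= s' <= h -> 0 <= t' <= h -> U (x + s' *: w + t' *: v).
  by move=> sh' th'; rewrite addrAC; exact: (Nh _ _ th' sh').1.
have [t' [s' [th' sh' E']]] := second_difference fs h0 Uh.
have {E'} E : 'D_w (fun y => 'D_v f y) (x + s *: v + t *: w) =
    'D_v (fun y => 'D_w f y) (x + t' *: w + s' *: v).
  apply: (mulIf (lt0r_neq0 h0)); apply: (mulIf (lt0r_neq0 h0)).
  apply: etrans (esym E) _; apply: etrans E'.
  by rewrite (addrAC x (h *: w)) (addrAC (f _)).
have [_ [_ /= N2]] := Nh _ _ sh th.
have := Nh _ _ sh' th'; rewrite (addrAC x) => -[_ [/= N1 _]].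
rewrite E in N2.
have close (a b c : R) : `|a - c| < e / 2 -> `|b - c| < e / 2 -> `|a - b| <= e.
  move=> ac bc; have -> : a - b = (a - c) - (b - c) by rewrite opprB subrKA.
  apply: le_trans (ler_normB _ _) _; rewrite [leRHS]splitr.
  exact: lerD (ltW ac) (ltW bc).
exact: close N1 N2.
Qed.

(** * Matrix-valued functions and curvature *)
Section MatrixDerivatives.
Context {R : realType} {V : normedModType R}.

Lemma is_derive_mx (p q : nat) (A : V -> 'M[R]_(p, q)) (D : 'M[R]_(p, q)) x v :
  (forall i j, is_derive x v (fun y => A y i j) (D i j)) -> is_derive x v A D.
Proof.
move=> H; have dA : derivable A x v by apply/derivable_mxP => i j; have [] := H i j.
by split => //; rewrite derive_mx //; apply/matrixP => i j; rewrite mxE derive_val.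
Qed.

Lemma derive_mxE (p q : nat) (A : V -> 'M[R]_(p, q)) x v i j :
  derivable A x v -> 'D_v A x i j = 'D_v (fun y => A y i j) x.
Proof. by move=> dA; rewrite derive_mx // mxE. Qed.

Lemma is_derive_mulmx (p q r : nat) (A : V -> 'M[R]_(p, q))
    (B : V -> 'M[R]_(q, r)) x v :
  derivable A x v -> derivable B x v ->
  is_derive x v (fun y => A y *m B y) ('D_v A x *m B x + A x *m 'D_v B x).
Proof.
move=> dA dB; apply: is_derive_mx => i j.
have -> : (fun y => (A y *m B y) i j) =
    \sum_k ((fun y => A y i k) * (fun y => B y k j)).
  by apply/funext => y; rewrite mxE fct_sumE.
rewrite !mxE -big_split /=; apply: is_derive_sum => k.
have /derivableP DA := (derivable_mxP A x v).1 dA i k.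
have /derivableP DB := (derivable_mxP B x v).1 dB k j.
apply: is_derive_eq; rewrite !derive_mxE // /GRing.scale /=.
by rewrite [RHS]addrC [X in _ + X = _]mulrC.
Qed.

Lemma is_derive_trmx (p q : nat) (A : V -> 'M[R]_(p, q)) x v :
  derivable A x v -> is_derive x v (fun y => (A y)^T) ('D_v A x)^T.
Proof.
move=> dA; apply: is_derive_mx => i j.
have -> : (fun y => (A y)^T i j) = (fun y => A y j i).
  by apply/funext => y; rewrite mxE.
rewrite mxE derive_mxE //; apply: derivableP.
exact: (derivable_mxP A x v).1.
Qed.

Lemma derivable_det (n : nat) (A : V -> 'M[R]_n) x v :
  derivable A x v -> derivable (fun y => \det (A y)) x v.
Proof.
elim: n A => [|n IHn] A /derivable_mxP dA.
  have -> : (fun y => \det (A y)) = cst 1.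
    by apply/funext => y; rewrite det_mx00.
  exact: derivable_cst.
have -> : (fun y => \det (A y)) = \sum_(j < n.+1) ((fun y => A y ord0 j) *
   ((-1) ^+ (@ord0 n + j) \*: (fun y => \det (row' ord0 (col' j (A y)))))).
  apply/funext => y; rewrite fct_sumE (expand_det_row _ ord0).
  by apply: eq_bigr.
apply: derivable_sum => j; apply: derivableM => //; apply: derivableZ.
apply: IHn; apply/derivable_mxP => i k.
have -> : (fun y => row' ord0 (col' j (A y)) i k) =
          (fun y => A y (lift ord0 i) (lift j k)).
  by apply/funext => y; rewrite !mxE.
exact: dA.
Qed.

(** Cramer's formula reduces the inverse to determinants; the formula for
    [invmx] has this shape only at invertible matrices, whence the hypothesis
    in a neighbourhood. *)
Lemma derivable_invmx (n : nat) (A : V -> 'M[R]_n) x v :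
  (\forall y \near x, A y \in unitmx) -> derivable A x v ->
  derivable (fun y => invmx (A y)) x v.
Proof.
move=> uA dA.
apply: (@near_eq_derivable _ _ _ (fun y => (\det (A y))^-1 *: \adj (A y))).
  by apply: filterS uA => y uy; rewrite /invmx uy.
apply/derivable_mxP => i j.
have -> : (fun y => ((\det (A y))^-1 *: \adj (A y)) i j) =
  (fun y => (\det (A y))^-1) *
  ((-1) ^+ (j + i) \*: (fun y => \det (row' j (col' i (A y))))).
  by apply/funext => y; rewrite !mxE.
apply: derivableM.
  apply: derivableV; last exact: derivable_det.
  by move: (nbhs_singleton uA); rewrite unitmxE unitfE.
apply/derivableZ/derivable_det/derivable_mxP => k l.
have -> : (fun y => row' j (col' i (A y)) k l) =
          (fun y => A y (lift j k) (lift i l)).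
  by apply/funext => y; rewrite !mxE.
exact: (derivable_mxP A x v).1.
Qed.

(** [P] and [Q] are the values of a connection form on the constant fields [v]
    and [w], which commute; no bracket term appears. *)
Definition curvature (n : nat) (v w : V) (P Q : V -> 'M[R]_n) (x : V) :
    'M[R]_n :=
  'D_v Q x - 'D_w P x + P x *m Q x - Q x *m P x.

Lemma smooth_mx_derivable (U : set V) (p q : nat) (A : V -> 'M[R]_(p, q)) x v :
  (forall i j, smooth_on U (fun y => A y i j)) -> U x -> derivable A x v.
Proof. by move=> sA Ux; apply/derivable_mxP => i j; exact: (sA i j [::] x Ux).2. Qed.

Lemma is_derive_derive_mx (U : set V) (p q : nat) (A : V -> 'M[R]_(p, q)) x v w :
  open U -> (forall i j, smooth_on U (fun y => A y i j)) -> U x ->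
  is_derive x v ('D_w A)
    (\matrix_(i, j) 'D_v (fun y => 'D_w (fun z => A z i j) y) x).
Proof.
move=> Uo sA Ux; apply: is_derive_mx => i j; rewrite mxE.
have E : {near x, (fun y => 'D_w (fun z => A z i j) y) =1 (fun y => 'D_w A y i j)}.
  apply: filterS (open_nbhs_nbhs (conj Uo Ux)) => y Uy.
  by rewrite derive_mxE //; exact: smooth_mx_derivable sA Uy.
apply: near_eq_is_derive E _; apply: derivableP.
exact: (sA i j [:: w] x Ux).2.
Qed.

Lemma derive_mx_comm (U : set V) (p q : nat) (A : V -> 'M[R]_(p, q)) x v w :
  open U -> (forall i j, smooth_on U (fun y => A y i j)) -> U x ->
  'D_v ('D_w A) x = 'D_w ('D_v A) x.
Proof.
move=> Uo sA Ux.
rewrite (@derive_val _ _ _ _ _ _ _ (is_derive_derive_mx v w Uo sA Ux)).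
rewrite (@derive_val _ _ _ _ _ _ _ (is_derive_derive_mx w v Uo sA Ux)).
apply: eq_mx => i j.
exact: (derive_comm v w Uo (sA i j) Ux).
Qed.

Lemma derive_parallel (U : set V) (n : nat) (A P P' : V -> 'M[R]_n) x v w :
  open U -> (forall i j, smooth_on U (fun y => A y i j)) -> U x ->
  derivable P x v -> derivable P' x v ->
  (forall y, U y -> 'D_w A y = A y *m P y - P' y *m A y) ->
  'D_v ('D_w A) x = 'D_v A x *m P x + A x *m 'D_v P x
                    - ('D_v P' x *m A x + P' x *m 'D_v A x).
Proof.
move=> Uo sA Ux dP dP' E.
have dA : derivable A x v := smooth_mx_derivable sA Ux.
have E' : {near x, 'D_w A =1 (fun y => A y *m P y) - (fun y => P' y *m A y)}.
  by apply: filterS (open_nbhs_nbhs (conj Uo Ux)) => y Uy; rewrite E.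
rewrite (near_eq_derive _ E').
have D := is_deriveB (is_derive_mulmx dA dP) (is_derive_mulmx dP' dA).
exact: (@derive_val _ _ _ _ _ _ _ D).
Qed.

(** The integrability condition for the system on the left: expand both sides
    of 'D_v ('D_w A) = 'D_w ('D_v A) and substitute the system for the first
    derivatives of [A]. The pair ([P'], [Q']) allows for two connections acting
    on the two sides of [A]. *)
Lemma parallel_curvature (U : set V) (n : nat) (A P Q P' Q' : V -> 'M[R]_n)
    x v w :
  open U -> (forall i j, smooth_on U (fun y => A y i j)) -> U x ->
  derivable P x w -> derivable Q x v -> derivable P' x w -> derivable Q' x v ->
  (forall y, U y -> 'D_v A y = A y *m P y - P' y *m A y) ->
  (forall y, U y -> 'D_w A y = A y *m Q y - Q' y *m A y) ->
  A x *m curvature v w P Q x = curvature v w P' Q' x *m A x.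
Proof.
move=> Uo sA Ux dP dQ dP' dQ' EP EQ.
have := derive_mx_comm v w Uo sA Ux.
rewrite (derive_parallel Uo sA Ux dQ dQ' EQ) (derive_parallel Uo sA Ux dP dP' EP).
rewrite (EP _ Ux) (EQ _ Ux) /curvature.
move: (A x) (P x) (Q x) (P' x) (Q' x) ('D_v Q x) ('D_w P x) ('D_v Q' x) ('D_w P' x).
move=> a p q p' q' dq dp dq' dp'.
rewrite !(mulmxBl, mulmxBr, mulmxDl, mulmxDr, mulmxN, mulNmx) !mulmxA.
move: (a *m p *m q) (p' *m a *m q) (a *m dq) (dq' *m a) (q' *m a *m p).
move: (q' *m p' *m a) (a *m q *m p) (a *m dp) (dp' *m a) (p' *m q' *m a).
move=> t0 t1 t2 t3 t4 t5 t6 t7 t8 t9 /matrixP E; apply/matrixP => i j.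
by have := E i j; rewrite !mxE => {}E; lra.
Qed.
End MatrixDerivatives.

Lemma curvature_skew (R : realType) (V : normedModType R) (n : nat) (v w : V)
    (P Q : V -> 'M[R]_n) x :
  curvature w v Q P x = - curvature v w P Q x.
Proof.
rewrite /curvature.
move: ('D_v Q x) ('D_w P x) (P x *m Q x) (Q x *m P x) => a b c d.
by apply/matrixP => i j; rewrite !mxE; ring.
Qed.

(** The dual connection, acting on covectors, has the opposite transpose of
    the curvature. *)
Lemma curvature_dual (R : realType) (V : normedModType R) (n : nat) (v w : V)
    (P Q : V -> 'M[R]_n) x :
  derivable P x w -> derivable Q x v ->
  curvature v w (fun y => - (P y)^T) (fun y => - (Q y)^T) x
  = - (curvature v w P Q x)^T.
Proof.
move=> dP dQ; rewrite /curvature.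
have DP := is_deriveN (is_derive_trmx dP).
have DQ := is_deriveN (is_derive_trmx dQ).
rewrite (@derive_val _ _ _ _ _ _ _ DP) (@derive_val _ _ _ _ _ _ _ DQ).
rewrite !(mulNmx, mulmxN) !opprK -!trmx_mul.
move: ('D_v Q x) ('D_w P x) (P x *m Q x) (Q x *m P x) => a b c d.
by apply/matrixP => i j; rewrite !mxE; ring.
Qed.

(** * Algebraic curvature tensors *)

(** The octahedron argument: the four Bianchi identities obtained by choosing
    the index that stays fixed are linear relations between the components
    with pairs {ab|cd}, {ac|bd} and {ad|bc}; combining them gives the claim. *)
Lemma curvature_pair_symmetry (R : realFieldType) (I : Type)
    (K : I -> I -> I -> I -> R) :
  (forall a b c d, K b a c d = - K a b c d) ->
  (forall a b c d, K a b d c = - K a b c d) ->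
  (forall a b c d, K a b d c + K b c d a + K c a d b = 0) ->
  forall a b c d, K a b c d = K c d a b.
Proof.
move=> K12 K34 B a b c d.
have := B a b c d; have := B b c d a; have := B c d a b; have := B d a b c.
rewrite ?[K _ _ b a]K34 ?[K _ _ c a]K34 ?[K _ _ d a]K34.
rewrite ?[K _ _ c b]K34 ?[K _ _ d b]K34 ?[K _ _ d c]K34.
rewrite ?[K b a _ _]K12 ?[K c a _ _]K12 ?[K d a _ _]K12.
rewrite ?[K c b _ _]K12 ?[K d b _ _]K12 ?[K d c _ _]K12.
lra.
Qed.

Section JacobiForm.
Context {R : realFieldType} {n : nat} (K : 'I_n -> 'I_n -> 'M[R]_n) (u : 'cV[R]_n).

(** The form (X, Y) |-> R(Y, u; X, u), in which [K a b c d] stands for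
    R(e_a, e_b; e_c, e_d). *)
Definition jacobi_form : 'M[R]_n :=
  \matrix_(l, m) \sum_j \sum_k K m j l k * u j 0 * u k 0.

Context (A : 'M[R]_n).
Context (K_skew12 : forall a b, K b a = - K a b)
  (K_skew34 : forall a b, (K a b)^T = - K a b)
  (K_bianchi : forall a b c d, K a b d c + K b c d a + K c a d b = 0)
  (K_comm : forall a b, A^T *m K a b = K a b *m A).

Let K_pair a b c d : K a b c d = K c d a b.
Proof.
apply: (@curvature_pair_symmetry _ _ (fun a b c d => K a b c d)) => //.
- by move=> i j k l; rewrite K_skew12 mxE.
- by move=> i j k l; have /matrixP/(_ k l) := K_skew34 i j; rewrite !mxE.
Qed.

Let v := A *m u.

(* R(JY, u; X, u) = R(X, u; Y, Ju): exchange the pairs and move [A] across the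
   matrix [K l j]. *)
Let jacobi_formM l m :
  (jacobi_form *m A) l m = \sum_j \sum_k K l j m k * v k 0 * u j 0.
Proof.
rewrite mxE.
transitivity (\sum_k u k 0 * (\sum_j (A^T *m K l k) m j * u j 0)).
  under [LHS]eq_bigr do rewrite mxE mulr_suml.
  under [LHS]eq_bigr do under eq_bigr do rewrite mulr_suml.
  under [RHS]eq_bigr do rewrite mulr_sumr.
  under [RHS]eq_bigr do under eq_bigr do rewrite mxE mulr_suml mulr_sumr.
  rewrite exchange_big /=.
  under [LHS]eq_bigr do rewrite exchange_big.
  rewrite exchange_big; apply: eq_bigr => k _; apply: eq_bigr => j _.
  apply: eq_bigr => p _; rewrite K_pair !mxE; ring.
apply: eq_bigr => j _; rewrite mulrC -mulr_suml; congr (_ * _).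
have -> : \sum_k (A^T *m K l j) m k * u k 0 = (A^T *m K l j *m u) m 0.
  by rewrite [RHS]mxE.
by rewrite K_comm -mulmxA mxE.
Qed.

Let Mjacobi_form l m :
  (A^T *m jacobi_form) l m = \sum_j \sum_k K m j l k * v k 0 * u j 0.
Proof.
rewrite mxE.
transitivity (\sum_j u j 0 * (\sum_k (A^T *m K m j) l k * u k 0)).
  under [LHS]eq_bigr do rewrite [jacobi_form _ _]mxE mulr_sumr.
  under [LHS]eq_bigr do under eq_bigr do rewrite mulr_sumr.
  under [RHS]eq_bigr do rewrite mulr_sumr.
  under [RHS]eq_bigr do under eq_bigr do rewrite mxE mulr_suml mulr_sumr.
  rewrite exchange_big /=; apply: eq_bigr => j _.
  rewrite exchange_big /=; apply: eq_bigr => k _.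
  apply: eq_bigr => p _; ring.
apply: eq_bigr => j _; rewrite mulrC -mulr_suml; congr (_ * _).
have -> : \sum_k (A^T *m K m j) l k * u k 0 = (A^T *m K m j *m u) l 0.
  by rewrite [RHS]mxE.
by rewrite K_comm -mulmxA mxE.
Qed.

(* R(X, Y; Au, u) is the value at (u, u) of the form A^T K_XY = K_XY A, which
   equals minus its transpose. *)
Let K_self l m : \sum_j \sum_k K l m k j * v k 0 * u j 0 = 0.
Proof.
have -> : \sum_j \sum_k K l m k j * v k 0 * u j 0 = (v^T *m K l m *m u) 0 0.
  rewrite mxE; apply: eq_bigr => j _; rewrite mxE mulr_suml.
  by apply: eq_bigr => k _; rewrite [v^T _ _]mxE; ring.
set q := _ *m u.
have qT : q^T = - q.
  rewrite /q /v !trmx_mul !trmxK K_skew34 !(mulNmx, mulmxN) !mulmxA.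
  by rewrite -(mulmxA u^T A^T) K_comm !mulmxA.
have := congr1 (fun M : 'M[R]_1 => M 0 0) qT; rewrite !mxE /=; lra.
Qed.

(** By [jacobi_formM] and [Mjacobi_form] the two sides are R(X, u; Y, Au) and
    R(Y, u; X, Au); the Bianchi identity turns their difference into a sum
    that vanishes by [K_self]. *)
Lemma jacobi_form_comm : jacobi_form *m A = A^T *m jacobi_form.
Proof.
apply/matrixP => l m; rewrite jacobi_formM Mjacobi_form.
apply/eqP; rewrite -subr_eq0 -sumrB; apply/eqP.
transitivity (- \sum_j \sum_k K l m k j * v k 0 * u j 0); last first.
  by rewrite K_self oppr0.
rewrite -sumrN; apply: eq_bigr => j _.
rewrite -sumrB -sumrN; apply: eq_bigr => k _.
have B := K_bianchi m k j l.
have E : K j m l k = - K m j l k by rewrite K_skew12 mxE.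
have -> : K l j m k = K m j l k - K l m k j.
  by rewrite (K_pair l j) (K_pair l m); lra.
ring.
Qed.
End JacobiForm.

(** * Auxiliary sums and constant functions *)
Lemma mulmx_entries_sum0 (R : pzSemiRingType) (p q r : nat) (M : 'M[R]_(p, q))
    (A B C : 'M[R]_(q, r)) l b c d :
  (forall i, A i d + B i b + C i c = 0) ->
  (M *m A) l d + (M *m B) l b + (M *m C) l c = 0.
Proof.
move=> ABC; rewrite !mxE -!big_split big1 // => i _ /=.
by rewrite -!mulrDr ABC mulr0.
Qed.

Lemma sum_delta_mx (R : nzSemiRingType) (n : nat) (p : 'I_n) (F : 'I_n -> R) :
  \sum_j F j * (delta_mx 0 p : 'rV[R]_n) 0 j = F p.
Proof.
rewrite (bigD1 p) //= big1 => [|j jp]; last first.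
  by rewrite mxE (negbTE jp) mulr0.
by rewrite mxE !eqxx mulr1 addr0.
Qed.

Lemma smooth_cst (R : realType) (V : normedModType R) (U : set V) (c : R) :
  smooth_on U (fun=> c).
Proof.
move=> s x Ux.
have [d ->] : exists d, iter_derive (fun=> c) s = cst d :> (V -> R).
  elim: s => [|v s [d IH]]; first by exists c.
  exists 0; apply/funext => y; rewrite /= -/(iter_derive _ s) IH.
  exact: derive_cst.
by split => [|v]; [exact: cvg_cst | exact: derivable_cst].
Qed.

(** The identity between components that underlies [jacobi_endomorphismE], with
    [G p j k] for Gamma^p_jk and [D p j k] for the derivative of Gamma^i_jk in
    the direction p. On the left are the three contributions to the defining
    identity for X = d/dq^m: Gamma applied to the fibre component of X^H, X^H
    applied to that of Gamma, and the lift of nabla X. *)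
Lemma jacobi_contraction (R : comNzRingType) (n : nat)
    (G : 'I_n -> 'I_n -> 'I_n -> R) (D : 'I_n -> 'I_n -> 'I_n -> R)
    (u : 'I_n -> R) i m :
  (forall p j k, G p j k = G p k j) ->
  \sum_p (u p * - (\sum_j D p m j * u j)
          + - (\sum_j \sum_k G p j k * u j * u k) * - G i m p)
  - (- (\sum_j \sum_k D m j k * u j * u k)
     + \sum_p - (\sum_j G p m j * u j) * - ((\sum_k G i p k * u k) *+ 2))
  + \sum_p (\sum_k G p m k * u k) * (\sum_j G i p j * u j)
  = \sum_j \sum_k (D m j k - D j m k + \sum_p G i m p * G p j k
                   - \sum_p G i j p * G p m k) * u j * u k.
Proof.
move=> sG.
pose A p := \sum_j D p m j * u j; pose S p := \sum_j \sum_k G p j k * u j * u k.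
pose N p q := \sum_j G p q j * u j.
have -> : \sum_j \sum_k (D m j k - D j m k + \sum_p G i m p * G p j k
                   - \sum_p G i j p * G p m k) * u j * u k
  = \sum_j \sum_k D m j k * u j * u k - \sum_p u p * A p
    + \sum_p G i m p * S p - \sum_p N p m * N i p.
  have -> : \sum_p u p * A p = \sum_j \sum_k D j m k * u j * u k.
    by apply: eq_bigr => j _; rewrite mulr_sumr; apply: eq_bigr => k _; ring.
  have -> : \sum_p G i m p * S p =
      \sum_j \sum_k (\sum_p G i m p * G p j k) * u j * u k.
    under [LHS]eq_bigr do rewrite mulr_sumr.
    rewrite exchange_big; apply: eq_bigr => j _.
    under [LHS]eq_bigr do rewrite mulr_sumr.
    rewrite exchange_big; apply: eq_bigr => k _ /=.
    by rewrite !mulr_suml; apply: eq_bigr => p _; ring.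
  have -> : \sum_p N p m * N i p =
      \sum_j \sum_k (\sum_p G i j p * G p m k) * u j * u k.
    under [LHS]eq_bigr do rewrite mulr_sumr.
    rewrite exchange_big; apply: eq_bigr => j _.
    under [LHS]eq_bigr do rewrite mulr_suml.
    rewrite exchange_big; apply: eq_bigr => k _ /=.
    by rewrite !mulr_suml; apply: eq_bigr => p _; rewrite (sG i p j); ring.
  rewrite -!sumrB -big_split -sumrB; apply: eq_bigr => j _ /=.
  rewrite -!sumrB -big_split -sumrB; apply: eq_bigr => k _ /=.
  by ring.
rewrite -/(N _ _).
have -> : \sum_p (u p * - (\sum_j D p m j * u j)
    + - (\sum_j \sum_k G p j k * u j * u k) * - G i m p) =
    - (\sum_p u p * A p) + \sum_p G i m p * S p.
  by rewrite -sumrN -big_split; apply: eq_bigr => p _ /=; rewrite /A /S; ring.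
have -> : \sum_p - (\sum_j G p m j * u j) * - ((\sum_k G i p k * u k) *+ 2) =
    (\sum_p N p m * N i p) *+ 2.
  by rewrite -sumrMnl; apply: eq_bigr => p _; rewrite /N; ring.
rewrite -[\sum_p _ * (\sum_j G i p j * u j)]/(\sum_p N p m * N i p).
by ring.
Qed.

(** * The Levi-Civita connection and the Jacobi endomorphism *)
Section LeviCivita.
Context {R : realType} {n : nat} {Q : smooth_manifold R n} (g : tensor02 Q)
  (g_sym : symmetric_tensor g) (g_unit : nonsingular g) (a : charts Q).

Local Notation T := (target (atlas a)).
Local Notation e k := (delta_mx 0 k : 'rV[R]_n).

Let T_nbhs x : T x -> nbhs x T.
Proof. by move=> Tx; apply: open_nbhs_nbhs; split => //; exact: open_target. Qed.

Definition connection_form (k : 'I_n) (x : 'rV[R]_n) : 'M[R]_n :=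
  \matrix_(i, j) christoffel g a i k j x.

Definition riemann (m k : 'I_n) (x : 'rV[R]_n) : 'M[R]_n :=
  curvature (e m) (e k) (connection_form m) (connection_form k) x.

Lemma partial_metric_sym i j k x : T x ->
  partial k (fun y => g a y i j) x = partial k (fun y => g a y j i) x.
Proof.
move=> Tx; apply: near_eq_derive; apply: filterS (T_nbhs Tx) => y Ty.
by rewrite -[in LHS](g_sym Ty) mxE.
Qed.

Lemma christoffel_sym i j k x : T x ->
  christoffel g a i j k x = christoffel g a i k j x.
Proof.
move=> Tx; rewrite /christoffel; congr (_ * _); apply: eq_bigr => l _.
by rewrite (partial_metric_sym j k l Tx) (addrC (partial j _ _)).
Qed.

Lemma derivable_christoffel i j k x v : T x ->
  derivable (christoffel g a i j k) x v.
Proof.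
move=> Tx.
have dg p q r : derivable (partial p (fun y => g a y q r)) x v.
  exact: ((@cov_smooth _ _ _ g a q r [:: e p] x Tx).2 v).
have di p q : derivable (fun y => invmx (g a y) p q) x v.
  apply: (derivable_mxP _ _ _).1; apply: derivable_invmx.
    by apply: filterS (T_nbhs Tx) => y; exact: g_unit.
  exact: smooth_mx_derivable (@cov_smooth _ _ _ g a) Tx.
have -> : christoffel g a i j k = 2^-1 \*: (\sum_(l < n)
    (fun y => invmx (g a y) i l) *
    (partial j (fun y => g a y l k) + partial k (fun y => g a y l j)
     - partial l (fun y => g a y j k))).
  by apply/funext => y; rewrite /= fct_sumE.
apply: derivableZ; apply: derivable_sum => l; apply: derivableM => //.
by apply: derivableB => //; apply: derivableD.
Qed.

Lemma derivable_connection_form k x v : T x -> derivable (connection_form k) x v.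
Proof.
move=> Tx; apply/derivable_mxP => i j.
have -> : (fun y => connection_form k y i j) = christoffel g a i k j.
  by apply/funext => y; rewrite mxE.
exact: derivable_christoffel.
Qed.

Lemma derive_connection_formE k x v i j : T x ->
  'D_v (connection_form k) x i j = 'D_v (christoffel g a i k j) x.
Proof.
move=> Tx; rewrite derive_mxE; last exact: derivable_connection_form.
by congr ('D_v _ x); apply/funext => y; rewrite mxE.
Qed.

Lemma lower_christoffel k x : T x ->
  g a x *m connection_form k x = \matrix_(l, j) (2^-1 *
    (partial k (fun y => g a y l j) x + partial j (fun y => g a y l k) x
     - partial l (fun y => g a y k j) x)).
Proof.
move=> Tx.
pose L := \matrix_(l, j) (2^-1 *
    (partial k (fun y => g a y l j) x + partial j (fun y => g a y l k) x
     - partial l (fun y => g a y k j) x)).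
have -> : connection_form k x = invmx (g a x) *m L.
  apply/matrixP => i j; rewrite !mxE /christoffel mulr_sumr.
  by apply: eq_bigr => l _; rewrite mxE mulrCA.
by rewrite mulKVmx //; exact: g_unit.
Qed.

(** nabla g = 0, written as a system of the form treated in
    [parallel_curvature], with the dual connection acting on the left. *)
Lemma connection_metric k x : T x ->
  'D_(e k) (g a) x = g a x *m connection_form k x
                     - (- (connection_form k x)^T) *m g a x.
Proof.
move=> Tx.
have E : (connection_form k x)^T *m g a x = (g a x *m connection_form k x)^T.
  by rewrite trmx_mul (g_sym Tx).
rewrite mulNmx opprK E (lower_christoffel k Tx).
apply/matrixP => l j; rewrite derive_mxE; last first.
  exact: smooth_mx_derivable (@cov_smooth _ _ _ g a) Tx.
rewrite -/(partial k (fun y => g a y l j) x) !mxE.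
rewrite (partial_metric_sym j l k Tx) (partial_metric_sym j k l Tx).
rewrite (partial_metric_sym k l j Tx).
move: (partial k _ x) (partial l _ x) (partial j _ x) => p q r.
by field.
Qed.

Lemma riemann_skew12 m k x : riemann k m x = - riemann m k x.
Proof. exact: curvature_skew. Qed.

(** [parallel_curvature] applied to the parallel tensor g. *)
Lemma riemann_skew34 m k x : T x ->
  (g a x *m riemann m k x)^T = - (g a x *m riemann m k x).
Proof.
move=> Tx.
have dc l w : derivable (connection_form l) x w by exact: derivable_connection_form.
have dc' l w : derivable (fun y => - (connection_form l y)^T) x w.
  by have [] := is_deriveN (is_derive_trmx (dc l w)).
have := parallel_curvature (@open_target _ _ _ (atlas a)) (@cov_smooth _ _ _ g a) Tx
  (dc m (e k)) (dc k (e m)) (dc' m (e k)) (dc' k (e m))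
  (fun y Ty => connection_metric m Ty) (fun y Ty => connection_metric k Ty).
rewrite -/(riemann m k x) curvature_dual // -/(riemann m k x) => E.
by rewrite trmx_mul (g_sym Tx) E mulNmx opprK.
Qed.

Lemma riemannE m k x i l : T x -> riemann m k x i l =
  'D_(e m) (christoffel g a i k l) x - 'D_(e k) (christoffel g a i m l) x
  + \sum_p christoffel g a i m p x * christoffel g a p k l x
  - \sum_p christoffel g a i k p x * christoffel g a p m l x.
Proof.
move=> Tx; rewrite /riemann /curvature.
move: (derive_connection_formE k (e m) i l Tx) (derive_connection_formE m (e k) i l Tx).
move: ('D_(e m) (connection_form k) x) ('D_(e k) (connection_form m) x) => A B EA EB.
have S p q : (connection_form p x *m connection_form q x) i l =
    \sum_r christoffel g a i p r x * christoffel g a r q l x.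
  by rewrite mxE; apply: eq_bigr => r _; rewrite !mxE.
move: (connection_form m x *m _) (connection_form k x *m _) (S m k) (S k m).
by move=> C D EC ED; rewrite !mxE EA EB EC ED.
Qed.

(** As the connection is torsion-free, Gamma^i_jk = Gamma^i_kj, the twelve
    terms cancel in pairs. *)
Lemma riemann_bianchi b c d x i : T x ->
  riemann b c x i d + riemann c d x i b + riemann d b x i c = 0.
Proof.
move=> Tx.
pose D w j k := 'D_(e w) (christoffel g a i j k) x.
pose q w j k := \sum_p christoffel g a i w p x * christoffel g a p j k x.
have RE m k l : riemann m k x i l = D m k l - D k m l + q m k l - q k m l.
  exact: riemannE.
have D_sym w j k : D w j k = D w k j.
  by apply: near_eq_derive; apply: filterS (T_nbhs Tx) => y; exact: christoffel_sym.
have q_sym w j k : q w j k = q w k j.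
  by apply: eq_bigr => p _; rewrite (christoffel_sym p j k Tx).
clearbody D q.
(* Replacing the three terms by congruence keeps the unifier from unfolding
   [riemann] in search of other occurrences. *)
apply: (etrans (f_equal2 +%R (f_equal2 +%R (RE b c d) (RE c d b)) (RE d b c))).
rewrite (D_sym c d b) (D_sym d c b) (D_sym b d c).
rewrite (q_sym c d b) (q_sym d c b) (q_sym b d c).
ring.
Qed.

(** At the velocity e_k the matrix J^i_{j|l} u^l reduces to J^i_{j|k}. *)
Lemma derive_parallel_endo (J : tensor11 Q) k x : T x ->
  nabla_endo g J a (x, e k) = 0 ->
  'D_(e k) (J a) x = J a x *m connection_form k x - connection_form k x *m J a x.
Proof.
move=> Tx /matrixP nJ; apply/matrixP => i j; move: (nJ i j); rewrite !mxE.
rewrite (bigD1 k) //= big1 => [|l lk]; last by rewrite mxE (negbTE lk) mulr0.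
rewrite mxE !eqxx mulr1 addr0 /covariant_derivative => E.
rewrite derive_mxE; last exact: smooth_mx_derivable (@endo_smooth _ _ _ J a) Tx.
have -> : \sum_l J a x i l * connection_form k x l j =
          \sum_l christoffel g a l k j x * J a x i l.
  by apply: eq_bigr => l _; rewrite mxE mulrC.
have -> : \sum_l connection_form k x i l * J a x l j =
          \sum_l christoffel g a i k l x * J a x l j.
  by apply: eq_bigr => l _; rewrite mxE.
by move/eqP: E; rewrite subr_eq0 => /eqP <-; rewrite addrK.
Qed.

Lemma riemann_comm (J : tensor11 Q) m k x : T x ->
  (forall z, tangent_target a z -> nabla_endo g J a z = 0) ->
  J a x *m riemann m k x = riemann m k x *m J a x.
Proof.
move=> Tx nJ.
have dc l w : derivable (connection_form l) x w by exact: derivable_connection_form.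
have par l y : T y -> 'D_(e l) (J a) y =
    J a y *m connection_form l y - connection_form l y *m J a y.
  by move=> Ty; apply: derive_parallel_endo => //; apply: nJ; split.
exact: parallel_curvature (@open_target _ _ _ (atlas a)) (@endo_smooth _ _ _ J a) Tx
  (dc m (e k)) (dc k (e m)) (dc m (e k)) (dc k (e m)) (par m) (par k).
Qed.

Lemma is_derive_connection i m x u v w : T x ->
  is_derive (x, u) (v, w) (fun z : 'rV[R]_n * 'rV[R]_n => - \sum_j christoffel g a i m j z.1 * z.2 0 j)
    (- \sum_j ('D_v (christoffel g a i m j) x * u 0 j
                + christoffel g a i m j x * w 0 j)).
Proof.
move=> Tx.
have -> : (fun z : 'rV[R]_n * 'rV[R]_n =>
    - \sum_j christoffel g a i m j z.1 * z.2 0 j) =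
    - (\sum_j (fun z : 'rV[R]_n * 'rV[R]_n => christoffel g a i m j z.1) *
       (fun z => z.2 0 j)).
  by apply/funext => z /=; rewrite fct_sumE.
apply: is_deriveN; apply: is_derive_sum => j.
have dc : derivable (christoffel g a i m j) x v by exact: derivable_christoffel.
have D := is_derive_base u w dc.
have Dj := is_derive_velocity j x u v w.
by apply: is_derive_eq; rewrite /GRing.scale /= addrC (mulrC (u 0 j)).
Qed.

Lemma is_derive_spray i x u v w : T x ->
  is_derive (x, u) (v, w) (du (geodesic_spray g a) i)
    (- \sum_j \sum_k ('D_v (christoffel g a i j k) x * u 0 j * u 0 k
       + christoffel g a i j k x * (w 0 j * u 0 k + u 0 j * w 0 k))).
Proof.
move=> Tx.
have -> : du (geodesic_spray g a) i = - (\sum_j \sum_k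
    (fun z : 'rV[R]_n * 'rV[R]_n => christoffel g a i j k z.1) * (fun z => z.2 0 j) * (fun z => z.2 0 k)).
  apply/funext => z /=; rewrite fct_sumE; congr (- _); apply: eq_bigr => j _.
  by rewrite fct_sumE.
apply: is_deriveN; apply: is_derive_sum => j; apply: is_derive_sum => k.
have dc : derivable (christoffel g a i j k) x v by exact: derivable_christoffel.
have D := is_derive_base u w dc.
have Dj := is_derive_velocity j x u v w.
have Dk := is_derive_velocity k x u v w.
apply: is_derive_eq; rewrite /GRing.scale /=.
rewrite !/(GRing.mul (_ : _ -> _) _) /=; ring.
Qed.

(** The fibre component of the defining identity of Phi, for the constant
    field X = d/dq^m along tau. *)
Lemma jacobi_endomorphismE (Phi : tensor11_along Q) x u i m :
  is_jacobi_endomorphism g Phi -> target (atlas a) x ->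
  Phi a (x, u) i m = \sum_j \sum_k riemann m j x i k * u 0 j * u 0 k.
Proof.
move=> Phi_jacobi Tx.
pose X (j : 'I_n) (z : 'rV[R]_n * 'rV[R]_n) : R := (j == m)%:R.
have sX j : smooth_on (tangent_target a) (X j) by exact: smooth_cst.
have zT : tangent_target a (x, u) by split.
have [_] := Phi_jacobi a X sX (x, u) zT i.
have N_E k : du (horizontal_lift g a X) k = (fun z : 'rV[R]_n * 'rV[R]_n =>
    - \sum_j christoffel g a k m j z.1 * z.2 0 j).
  apply/funext => z /=; congr (- _).
  rewrite (bigD1 m) //= [X in _ + X]big1 => [|l lm]; last first.
    by rewrite big1 // => j _; rewrite /X (negbTE lm) !mul0r.
  by rewrite addr0; apply: eq_bigr => j _; rewrite /X eqxx mul1r.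
have X_const A k z : lie_derive A (X k) z = 0.
  rewrite /lie_derive big1 // => j _.
  by rewrite /partial_q /partial_u !derive_cst !mulr0 addr0.
have nX k : nabla_field g a X k (x, u) = \sum_j christoffel g a k m j x * u 0 j.
  rewrite /nabla_field X_const add0r (bigD1 m) //= [X in _ + X]big1 => [|l lm].
    by rewrite addr0; apply: eq_bigr => j _; rewrite /X eqxx mulr1.
  by rewrite big1 // => j _; rewrite /X (negbTE lm) mulr0.
have Nq p : partial_q p (du (horizontal_lift g a X) i) (x, u) =
    - \sum_j 'D_(e p) (christoffel g a i m j) x * u 0 j.
  rewrite N_E /partial_q.
  rewrite (@derive_val _ _ _ _ _ _ _ (is_derive_connection i m u (e p) 0 Tx)).
  by congr (- _); apply: eq_bigr => j _; rewrite mxE mulr0 addr0.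
have Nu p : partial_u p (du (horizontal_lift g a X) i) (x, u) =
    - christoffel g a i m p x.
  rewrite N_E /partial_u.
  rewrite (@derive_val _ _ _ _ _ _ _ (is_derive_connection i m u 0 (e p) Tx)).
  rewrite -[in RHS](sum_delta_mx p (fun j => christoffel g a i m j x)).
  by congr (- _); apply: eq_bigr => j _; rewrite derive0 mul0r add0r.
have Sq p : partial_q p (du (geodesic_spray g a) i) (x, u) =
    - \sum_j \sum_k 'D_(e p) (christoffel g a i j k) x * u 0 j * u 0 k.
  rewrite /partial_q.
  rewrite (@derive_val _ _ _ _ _ _ _ (is_derive_spray i u (e p) 0 Tx)).
  congr (- _); apply: eq_bigr => j _; apply: eq_bigr => k _.
  by rewrite !mxE mul0r !mulr0 addr0 mulr0 addr0.
have Su p : partial_u p (du (geodesic_spray g a) i) (x, u) =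
    - ((\sum_k christoffel g a i p k x * u 0 k) *+ 2).
  rewrite /partial_u.
  rewrite (@derive_val _ _ _ _ _ _ _ (is_derive_spray i u 0 (e p) Tx)).
  congr (- _).
  transitivity (\sum_j (\sum_k christoffel g a i j k x * u 0 k) * (e p) 0 j
     + \sum_j u 0 j * (\sum_k christoffel g a i j k x * (e p) 0 k)).
    rewrite -big_split; apply: eq_bigr => j _ /=.
    rewrite mulr_suml mulr_sumr -big_split; apply: eq_bigr => k _ /=.
    by rewrite derive0 !mul0r add0r; ring.
  rewrite sum_delta_mx mulr2n; congr (_ + _); apply: eq_bigr => j _.
  by rewrite sum_delta_mx (christoffel_sym i j p Tx) mulrC.
(* The hypotheses [Nq] to [Su] are the partial derivatives of the fibre
   components of X^H and of the spray; they give the two halves of the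
   bracket. *)
have lieS : lie_derive (geodesic_spray g a) (du (horizontal_lift g a X) i) (x, u) =
    \sum_p (u 0 p * - (\sum_j 'D_(e p) (christoffel g a i m j) x * u 0 j)
      + - (\sum_j \sum_k christoffel g a p j k x * u 0 j * u 0 k)
        * - christoffel g a i m p x).
  by apply: eq_bigr => p _; rewrite Nq Nu.
have lieX : lie_derive (horizontal_lift g a X) (du (geodesic_spray g a) i) (x, u) =
    - (\sum_j \sum_k 'D_(e m) (christoffel g a i j k) x * u 0 j * u 0 k)
    + \sum_p - (\sum_j christoffel g a p m j x * u 0 j)
             * - ((\sum_k christoffel g a i p k x * u 0 k) *+ 2).
  rewrite /lie_derive big_split; congr (_ + _).
    rewrite (bigD1 m) //= [X in _ + X]big1 => [|l lm].
      by rewrite addr0 /X eqxx mul1r Sq.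
    by rewrite /X (negbTE lm) mul0r.
  by apply: eq_bigr => p _; rewrite N_E Su.
have liftX : du (horizontal_lift g a (nabla_field g a X)) i (x, u) =
    - \sum_p (\sum_k christoffel g a p m k x * u 0 k)
            * (\sum_j christoffel g a i p j x * u 0 j).
  congr (- _); apply: eq_bigr => p _; rewrite mulr_sumr.
  by apply: eq_bigr => j _; rewrite nX mulrA.
have PhiX : \sum_j Phi a (x, u) i j * X j (x, u) = Phi a (x, u) i m.
  rewrite (bigD1 m) //= big1 => [|l lm]; first by rewrite /X eqxx mulr1 addr0.
  by rewrite /X (negbTE lm) mulr0.
have -> : \sum_j \sum_k riemann m j x i k * u 0 j * u 0 k =
    \sum_j \sum_k ('D_(e m) (christoffel g a i j k) x
      - 'D_(e j) (christoffel g a i m k) x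
      + \sum_p christoffel g a i m p x * christoffel g a p j k x
      - \sum_p christoffel g a i j p x * christoffel g a p m k x) * u 0 j * u 0 k.
  apply: eq_bigr => j _; apply: eq_bigr => k _.
  by rewrite (riemannE m j i k Tx).
rewrite -(@jacobi_contraction _ _ (fun p j k => christoffel g a p j k x)
  (fun p j k => 'D_(e p) (christoffel g a i j k) x) (u 0) i m); last first.
  by move=> p j k; exact: christoffel_sym.
rewrite -lieS -lieX => E.
have {}E : lie_derive (geodesic_spray g a) (du (horizontal_lift g a X) i) (x, u)
    - lie_derive (horizontal_lift g a X) (du (geodesic_spray g a) i) (x, u)
    = du (horizontal_lift g a (nabla_field g a X)) i (x, u)
    + \sum_j Phi a (x, u) i j * X j (x, u) := E.
by rewrite E PhiX liftX addrAC addNr add0r.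
Qed.

End LeviCivita.

(** * The theorem *)
Lemma self_transpose (R : realType) (n : nat) (Q : smooth_manifold R n)
    (g : tensor02 Q) (J Jbar : tensor11 Q) a x :
  is_transpose g J Jbar -> eq_tensor11 J Jbar -> target (atlas a) x ->
  (J a x)^T *m g a x = g a x *m J a x.
Proof.
move=> JT JE Tx; apply/matrixP => i j.
have entry (M : 'M[R]_n) :
    ((delta_mx i 0 : 'cV[R]_n)^T *m M *m delta_mx j 0 : 'M[R]_1) 0 0 = M i j.
  by rewrite trmx_delta -rowE -colE !mxE.
have := JT a x Tx (delta_mx i 0) (delta_mx j 0).
rewrite -(JE a x Tx) trmx_mul !mulmxA => E.
by rewrite -(entry (_ *m g a x)) -(entry (g a x *m _)) !mulmxA E.
Qed.

Theorem mainTheorem8 (R : realType) (n : nat) (Q : smooth_manifold R n)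
    (g : tensor02 Q) (J Jbar : tensor11 Q) (Phi : tensor11_along Q) :
  symmetric_tensor g ->
  nonsingular g ->
  is_transpose g J Jbar ->
  is_jacobi_endomorphism g Phi ->
  eq_tensor11 J Jbar ->
  (forall (a : charts Q) (z : 'rV[R]_n * 'rV[R]_n),
     tangent_target a z -> nabla_endo g J a z = 0) ->
  forall (a : charts Q) (z : 'rV[R]_n * 'rV[R]_n),
    tangent_target a z ->
    Phi a z *m J a z.1 = J a z.1 *m Phi a z.
Proof.
move=> g_sym g_unit JT Phi_jacobi JE nJ a [x u] [/= Tx _].
pose K m k := g a x *m riemann g a m k x.
have JgE := self_transpose JT JE Tx.
have PhiE : g a x *m Phi a (x, u) = jacobi_form K u^T.
  apply/matrixP => l m; rewrite [LHS]mxE [RHS]mxE.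
  under [LHS]eq_bigr do
    rewrite (jacobi_endomorphismE g_sym g_unit u _ _ Phi_jacobi Tx) mulr_sumr.
  rewrite exchange_big; apply: eq_bigr => j _ /=.
  under [LHS]eq_bigr do rewrite mulr_sumr.
  rewrite exchange_big; apply: eq_bigr => k _ /=.
  rewrite [K m j l k]mxE !mulr_suml; apply: eq_bigr => i _.
  by rewrite [u^T j 0]mxE [u^T k 0]mxE !mulrA.
have K_comm m k : (J a x)^T *m K m k = K m k *m J a x.
  by rewrite /K mulmxA JgE -!mulmxA (riemann_comm g_unit m k Tx (nJ a)).
have K_skew12 m k : K k m = - K m k by rewrite /K riemann_skew12 mulmxN.
have K_skew34 m k : (K m k)^T = - K m k.
  exact: riemann_skew34.
have K_bianchi b c d l : K b c l d + K c d l b + K d b l c = 0.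
  exact: mulmx_entries_sum0 (fun p => riemann_bianchi g_sym g_unit b c d p Tx).
have F := jacobi_form_comm u^T K_skew12 K_skew34 K_bianchi K_comm.
rewrite -(mulKmx (g_unit a x Tx) (Phi a (x, u) *m J a x)).
rewrite -(mulKmx (g_unit a x Tx) (J a x *m Phi a (x, u))).
by congr (_ *m _); rewrite !mulmxA PhiE F -JgE -mulmxA PhiE.
Qed.
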